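(* Let $\mathcal{H}$ be an infinite-dimensional separable Hilbert space and let $\Phi=\{\varphi_n\}_{n\in\mathbb{N}}$ be a frame for $\mathcal{H}$ with frame bounds $0<A\leq B<\infty$. For each $m\in\mathbb{N}$ let $V_m$ be a finite-dimensional subspace of $\mathcal{H}$, with $\dim(V_{m+1})>\dim(V_m)$ for every $m$. Suppose there is an increasing function $G:\mathbb{N}\to(0,\infty)$ with $\lim_{m\to\infty}G(m)=\infty$ such that for every $m\in\mathbb{N}$ and every $f,g\in V_m$ $$\inf_{|\alpha|=1}\|f-\alpha g\|\leq G(m)\,\|\mathcal{A}_{\Phi}(f)-\mathcal{A}_{\Phi}(g)\|.$$ For $\gamma>1$ and $R>0$ define $$\mathcal{B}_{\gamma}(R)=\{f\in\mathcal{H}:\ \|f-P_mf\|\leq G(m+1)^{-\gamma}R\|f\|\ \text{ for every } m\in\mathbb{N}\},$$ where $P_m$ denotes the orthogonal projection of $\mathcal{H}$ onto $V_m$. Then for every $f,g\in\mathcal{B}_{\gamma}(R)$ $$\inf_{|\alpha|=1}\|f-\alpha g\|\leq C\,\left(\|f\|+\|g\|\right)^{1/\gamma}\,\|\mathcal{A}_{\Phi}(f)-\mathcal{A}_{\Phi}(g)\|^{\frac{\gamma-1}{\gamma}},$$ where $C$ is a constant depending only on $B$, $R$, $\gamma$ and $G(1)$.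
   Context: The Hilbert space $\mathcal{H}$ is over $\mathbb{R}$ or $\mathbb{C}$. A countable family $\Phi=\{\varphi_n\}_{n\in I}\subseteq\mathcal{H}$ is a frame for $\mathcal{H}$ with frame bounds $0<A\le B<\infty$ if $A\|f\|^2\leq\sum_{n\in I}|\langle f,\varphi_n\rangle|^2\leq B\|f\|^2$ for every $f\in\mathcal{H}$. The (nonlinear) map $\mathcal{A}_{\Phi}:\mathcal{H}\to\ell^2(I)$ is $\mathcal{A}_{\Phi}(f)=(|\langle f,\varphi_n\rangle|)_{n\in I}$. The norm of $\mathcal{A}_{\Phi}(f)-\mathcal{A}_{\Phi}(g)$ is the $\ell^2(I)$ norm. The infimum over $|\alpha|=1$ is over unimodular elements $\alpha$ of the scalar field of $\mathcal{H}$. Here $\mathbb{N}=\{1,2,3,\dots\}$. *)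

(* Defs.v *)
From HB Require Import structures.
From mathcomp Require Import all_boot all_order all_algebra.
From mathcomp Require Import sesquilinear complex.
From mathcomp Require Import all_classical all_reals all_analysis.

Set Implicit Arguments.
Unset Strict Implicit.
Unset Printing Implicit Defensive.

Import Order.TTheory GRing.Theory Num.Theory.
Import numFieldNormedType.Exports.

Local Open Scope classical_set_scope.
Local Open Scope ring_scope.

Variant scalar_kind := RealScalars | ComplexScalars.

Section Scalars.
Variable R : realType.

Definition scalar (k : scalar_kind) : numFieldType :=
  match k with
  | RealScalars => R
  | ComplexScalars => complex R
  end.

Definition scalar_conj (k : scalar_kind) : {rmorphism scalar k -> scalar k} :=
  match k return {rmorphism scalar k -> scalar k} with
  | RealScalars => idfun
  | ComplexScalars => @Num.conj (complex R)
  end.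

Definition scalar_re (k : scalar_kind) : scalar k -> R :=
  match k return scalar k -> R with
  | RealScalars => fun x => x
  | ComplexScalars => fun z => complex.Re z
  end.

End Scalars.

(* The inner product is linear in its first argument and conjugate-linear in
   its second one. *)
Record hilbert (R : realType) (k : scalar_kind) := Hilbert {
  hilbert_carrier :> completeNormedModType (scalar R k) ;
  inner : {dot hilbert_carrier for scalar_conj R k} ;
  norm_inner : forall x : hilbert_carrier, `|x| ^+ 2 = inner x x
}.

Section RealNorm.
Variables (R : realType) (k : scalar_kind).

(* The norm of a normed module over K, and the absolute
   value of K itself, take their values in K; when K = R[i] these values are
   nonnegative reals seen in R[i], and [scalar_re] brings them back to R. *)
Definition rnorm (V : normedModType (scalar R k)) (x : V) : R :=
  scalar_re `|x|.

Definition rabs (a : scalar R k) : R := scalar_re `|a|.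

End RealNorm.

Section Subspaces.
Variables (K : numFieldType) (V : lmodType K).

Definition lin_free n (e : 'I_n -> V) : Prop :=
  forall c : 'I_n -> K, \sum_(i < n) c i *: e i = 0 -> forall i, c i = 0.

Definition lin_span n (e : 'I_n -> V) : set V :=
  [set x | exists c : 'I_n -> K, x = \sum_(i < n) c i *: e i].

(* [W] is a linear subspace of finite dimension [n] *)
Definition has_dim (W : set V) (n : nat) : Prop :=
  exists e : 'I_n -> V, lin_free e /\ W = lin_span e.

Definition infinite_dimensional : Prop := forall n, ~ has_dim setT n.

End Subspaces.

Definition separable (T : topologicalType) : Prop :=
  exists2 D : set T, countable D & dense D.

Section PhaseRetrieval.
Variables (R : realType) (k : scalar_kind) (H : hilbert R k).

Definition frame (Phi : nat -> H) (A B : R) : Prop :=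
  [/\ 0 < A, A <= B &
    forall f : H,
      ((A * rnorm f ^+ 2)%:E
         <= \sum_(0 <= n <oo) (rabs (inner H f (Phi n)) ^+ 2)%:E
         <= (B * rnorm f ^+ 2)%:E)%E].

Definition ampl (Phi : nat -> H) (f : H) : nat -> R :=
  fun n => rabs (inner H f (Phi n)).

(* The l^2 norm of [ampl Phi f - ampl Phi g]; it is finite as soon as [Phi]
   has an upper frame bound, so that [fine] loses nothing. *)
Definition ampl_dist (Phi : nat -> H) (f g : H) : R :=
  fine ('N[counting]_2%:E [EFin \o (ampl Phi f \- ampl Phi g)%R])%E.

Definition phase_dist (f g : H) : R :=
  inf [set rnorm (f - alpha *: g) | alpha in [set a : scalar R k | rabs a = 1]].

(* For a finite-dimensional subspace [W] the point sought exists and is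
   unique; 0 is only the default value of [xget]. *)
Definition orthoproj (W : set H) (f : H) : H :=
  xget 0 [set p | W p /\ forall w, W w -> inner H (f - p) w = 0].

Definition approx_class (V : nat -> set H) (G : nat -> R) (gamma r : R)
    : set H :=
  [set f | forall m, rnorm (f - orthoproj (V m) f)
                     <= G m.+1 `^ (- gamma) * r * rnorm f].

End PhaseRetrieval.

(* Main.v *)
(* Write S = ||f|| + ||g|| and D = ||A_Phi(f) - A_Phi(g)||. Comparing f and g
   with P_m f and P_m g, where the stability hypothesis holds, and using that
   A_Phi is sqrt(B)-Lipschitz gives, for every m,
     dist(f, g) <= G(m) D + K G(m+1)^(1 - gamma) S,
     K = (1 / G(1) + sqrt(B)) R.
   At t = (S / D)^(1 / gamma) the quantities t D and t^(1 - gamma) S coincide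
   and equal S^(1 / gamma) D^((gamma - 1) / gamma), so it suffices to take m
   with G(m) <= t < G(m+1). If t < G(1) there is no such m, but then
   dist(f, g) <= S = t^(gamma - 1) (t D) <= G(1)^(gamma - 1) (t D). If D = 0,
   let m tend to infinity. *)
Require Import Defs.
From HB Require Import structures.
From mathcomp Require Import all_boot all_order all_algebra.
From mathcomp Require Import sesquilinear complex.
From mathcomp Require Import all_classical all_reals all_analysis.
From mathcomp Require Import ring lra.

Set Implicit Arguments.
Unset Strict Implicit.
Unset Printing Implicit Defensive.

Import Order.TTheory GRing.Theory Num.Theory.
Import numFieldNormedType.Exports.

Local Open Scope classical_set_scope.
Local Open Scope ring_scope.

(** * Real-valued norms and moduli, uniformly in the scalar field *)

(* [Defs.scalar] is qualified because MathComp's own [scalar] shadows it. *)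
Lemma le_scalar_re (R : realType) (k : scalar_kind) (x y : Defs.scalar R k) :
  x <= y -> scalar_re x <= scalar_re y.
Proof. by case: k x y => //= -[a b] [c d]; rewrite lecE => /andP[]. Qed.

Lemma scalar_reD (R : realType) (k : scalar_kind) (x y : Defs.scalar R k) :
  scalar_re (x + y) = scalar_re x + scalar_re y.
Proof. by case: k x y => //= -[a b] [c d]. Qed.

Lemma scalar_re_ge0 (R : realType) (k : scalar_kind) (x : Defs.scalar R k) :
  0 <= x -> 0 <= scalar_re x.
Proof. by move/le_scalar_re; case: k x. Qed.

(** Real parts do not multiply in general; in the order of [complex R], [0 <= x] forces the
    imaginary part of [x] to vanish. *)
Lemma scalar_reM (R : realType) (k : scalar_kind) (x y : Defs.scalar R k) :
  0 <= x -> scalar_re (x * y) = scalar_re x * scalar_re y.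
Proof.
case: k x y => //= -[a b] [c d]; rewrite lecE /= => /andP[/eqP -> _].
by rewrite mul0r subr0.
Qed.

Lemma rnorm_ge0 (R : realType) (k : scalar_kind)
  (V : normedModType (Defs.scalar R k)) (x : V) : 0 <= rnorm x.
Proof. exact/scalar_re_ge0/normr_ge0. Qed.

Lemma ler_rnormD (R : realType) (k : scalar_kind)
  (V : normedModType (Defs.scalar R k)) (x y : V) :
  rnorm (x + y) <= rnorm x + rnorm y.
Proof. by rewrite /rnorm -scalar_reD; exact/le_scalar_re/ler_normD. Qed.

Lemma rnormN (R : realType) (k : scalar_kind)
  (V : normedModType (Defs.scalar R k)) (x : V) : rnorm (- x) = rnorm x.
Proof. by rewrite /rnorm normrN. Qed.

Lemma rnormZ (R : realType) (k : scalar_kind)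
  (V : normedModType (Defs.scalar R k)) (a : Defs.scalar R k) (x : V) :
  rnorm (a *: x) = rabs a * rnorm x.
Proof. by rewrite /rnorm normrZ scalar_reM. Qed.

Lemma ler_rnormB (R : realType) (k : scalar_kind)
  (V : normedModType (Defs.scalar R k)) (x y : V) :
  rnorm (x - y) <= rnorm x + rnorm y.
Proof. by rewrite -[in leRHS](rnormN y) ler_rnormD. Qed.

Lemma rnorm_distC (R : realType) (k : scalar_kind)
  (V : normedModType (Defs.scalar R k)) (x y : V) : rnorm (x - y) = rnorm (y - x).
Proof. by rewrite -rnormN opprB. Qed.

Lemma rabs_ge0 (R : realType) (k : scalar_kind) (a : Defs.scalar R k) : 0 <= rabs a.
Proof. exact/scalar_re_ge0/normr_ge0. Qed.

Lemma rabs1 (R : realType) (k : scalar_kind) : rabs (1 : Defs.scalar R k) = 1.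
Proof. by rewrite /rabs normr1; case: k. Qed.

Lemma ler_rabs_dist (R : realType) (k : scalar_kind) (a b : Defs.scalar R k) :
  `|rabs a - rabs b| <= rabs (a - b).
Proof.
have le (c d : Defs.scalar R k) : rabs c <= rabs d + rabs (c - d).
  by rewrite -scalar_reD; apply: le_scalar_re; rewrite -{1}(subrKC d c) ler_normD.
rewrite ler_norml lerBlDl le andbT lerNl opprB lerBlDl.
by have := le b a; rewrite {3}/rabs distrC.
Qed.

(** * Distance modulo a global phase *)

Lemma phase_dist_lb (R : realType) (k : scalar_kind) (H : hilbert R k) (f g : H) :
  lbound [set rnorm (f - alpha *: g) | alpha in [set a : Defs.scalar R k | rabs a = 1]] 0.
Proof. by move=> _ [a _ <-]; exact: rnorm_ge0. Qed.

Lemma phase_dist_le (R : realType) (k : scalar_kind) (H : hilbert R k) (f g : H)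
  (a : Defs.scalar R k) : rabs a = 1 -> phase_dist f g <= rnorm (f - a *: g).
Proof.
move=> a1; apply: ge_inf; first by exists 0; exact: phase_dist_lb.
by exists a.
Qed.

Lemma phase_dist_leD (R : realType) (k : scalar_kind) (H : hilbert R k)
  (f g : H) : phase_dist f g <= rnorm f + rnorm g.
Proof.
apply: (le_trans (phase_dist_le f g (rabs1 R k))).
by rewrite scale1r ler_rnormB.
Qed.

(** For unimodular [a], split [f - a *: g] as [(f - p) + a *: (q - g) + (p - a *: q)]. The first two
    norms do not depend on [a], so the infimum can be taken over the last. *)
Lemma phase_dist_perturb (R : realType) (k : scalar_kind) (H : hilbert R k)
  (f g p q : H) :
  phase_dist f g <= rnorm (f - p) + rnorm (g - q) + phase_dist p q.
Proof.
rewrite -lerBlDl; apply: lb_le_inf.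
  by exists (rnorm (p - 1 *: q)); exists 1 => //; exact: rabs1.
move=> _ [a /= a1 <-]; rewrite lerBlDl.
apply: (le_trans (phase_dist_le f g a1)).
have -> : f - a *: g = (f - p) + a *: (q - g) + (p - a *: q).
  by rewrite scalerBr addrAC !addrA !subrK.
apply: (le_trans (ler_rnormD _ _)); rewrite lerD2r.
apply: (le_trans (ler_rnormD _ _)); rewrite lerD2l.
by rewrite rnormZ a1 mul1r rnorm_distC.
Qed.

(** * Lipschitz and triangle inequalities for amplitudes *)

(** The reverse triangle inequality bounds each term by the modulus of a frame coefficient of
    [f - g]; the upper frame bound sums the squares. Stated in the extended reals, the bound also
    yields finiteness. *)
Lemma Lnorm_ampl_le (R : realType) (k : scalar_kind) (H : hilbert R k)
  (Phi : nat -> H) (A B : R) (f g : H) : frame Phi A B ->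
  ('N[counting]_2%:E [EFin \o (ampl Phi f \- ampl Phi g)%R]
    <= (Num.sqrt B * rnorm (f - g))%:E)%E.
Proof.
move=> [A0 AB HF]; rewrite Lnorm_counting//.
have B0 : 0 <= B by rewrite (le_trans (ltW A0)).
have -> : (Num.sqrt B * rnorm (f - g))%:E =
    ((B * rnorm (f - g) ^+ 2)%:E `^ 2^-1)%E.
  rewrite poweR_EFin powR12_sqrt ?(mulr_ge0 _ (sqr_ge0 _))// sqrtrM// sqrtr_sqr.
  by rewrite ger0_norm ?rnorm_ge0.
apply: gt0_ler_poweR; rewrite ?invr_ge0//.
- rewrite in_itv/= leey andbT; apply: nneseries_ge0 => n _ _.
  by rewrite lee_fin powR_ge0.
- by rewrite in_itv/= leey andbT lee_fin (mulr_ge0 _ (sqr_ge0 _)).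
have /andP[_] := HF (f - g); apply: le_trans.
apply: lee_nneseries => [n _ _|n _]; first exact: poweR_ge0.
rewrite lee_fin powR_mulrn//.
rewrite ler_sqr ?nnegrE ?rabs_ge0//.
by rewrite linearBl; exact: ler_rabs_dist.
Qed.

Lemma EFin_ampl_dist (R : realType) (k : scalar_kind) (H : hilbert R k)
  (Phi : nat -> H) (A B : R) (f g : H) : frame Phi A B ->
  (ampl_dist Phi f g)%:E
    = ('N[counting]_2%:E [EFin \o (ampl Phi f \- ampl Phi g)%R])%E.
Proof.
move=> /(Lnorm_ampl_le f g) le; rewrite /ampl_dist fineK//.
by rewrite ge0_fin_numE ?Lnorm_ge0// (le_lt_trans le) ?ltry.
Qed.

Lemma ampl_dist_ge0 (R : realType) (k : scalar_kind) (H : hilbert R k)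
  (Phi : nat -> H) (f g : H) : 0 <= ampl_dist Phi f g.
Proof. by rewrite /ampl_dist fine_ge0// Lnorm_ge0. Qed.

Lemma ampl_dist_le (R : realType) (k : scalar_kind) (H : hilbert R k)
  (Phi : nat -> H) (A B : R) (f g : H) : frame Phi A B ->
  ampl_dist Phi f g <= Num.sqrt B * rnorm (f - g).
Proof.
by move=> HF; rewrite -lee_fin (EFin_ampl_dist _ _ HF) (Lnorm_ampl_le _ _ HF).
Qed.

Lemma ampl_dist_triangle (R : realType) (k : scalar_kind) (H : hilbert R k)
  (Phi : nat -> H) (A B : R) (f g h : H) : frame Phi A B ->
  ampl_dist Phi f h <= ampl_dist Phi f g + ampl_dist Phi g h.
Proof.
move=> HF; rewrite -lee_fin EFinD !(EFin_ampl_dist _ _ HF).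
have -> : (ampl Phi f \- ampl Phi h)%R =
    ((ampl Phi f \- ampl Phi g) \+ (ampl Phi g \- ampl Phi h))%R.
  by apply/funext => n /=; rewrite addrA subrK.
by apply: minkowski_EFin => //; rewrite ler1n.
Qed.

(* The default value 0 of [orthoproj] also lies in [W], so the existence of
   orthogonal projections is not needed. *)
Lemma orthoproj_in (R : realType) (k : scalar_kind) (H : hilbert R k)
  (W : set H) n (f : H) : has_dim W n -> W (orthoproj W f).
Proof.
move=> [e [_ ->]]; rewrite /orthoproj; case: xgetP => [x _ []//|_].
by exists (fun=> 0); rewrite big1// => i _; rewrite scale0r.
Qed.

(** Here [c] is the stability constant at [(p, q)] and [x] the relative approximation error.
    Amplitudes are compared along the chain [p], [f], [g], [q], whose outer links cost [Num.sqrt B]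
    times that error. *)
Lemma phase_dist_level (R : realType) (k : scalar_kind) (H : hilbert R k)
  (Phi : nat -> H) (A B : R) (HPhi : frame Phi A B)
  (f g p q : H) (c x : R) : 0 <= c ->
  phase_dist p q <= c * ampl_dist Phi p q ->
  rnorm (f - p) <= x * rnorm f -> rnorm (g - q) <= x * rnorm g ->
  phase_dist f g <= c * ampl_dist Phi f g
    + (1 + c * Num.sqrt B) * x * (rnorm f + rnorm g).
Proof.
move=> c0 pq fp gq.
apply: (le_trans (phase_dist_perturb f g p q)).
have ap : ampl_dist Phi p q <=
    Num.sqrt B * rnorm (f - p) + (ampl_dist Phi f g + Num.sqrt B * rnorm (g - q)).
  apply: (le_trans (ampl_dist_triangle p f q HPhi)); apply: lerD.
    by rewrite rnorm_distC; exact: ampl_dist_le HPhi.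
  apply: (le_trans (ampl_dist_triangle f g q HPhi)); rewrite lerD2l.
  exact: ampl_dist_le HPhi.
have := ler_wpM2l c0 ap; have s0 := sqrtr_ge0 B.
have := ler_wpM2l (mulr_ge0 c0 s0) fp; have := ler_wpM2l (mulr_ge0 c0 s0) gq.
by nra.
Qed.

(** * Choice of the approximation level *)

Lemma le_powR_opp (R : realType) (e x y : R) : 0 <= e -> 0 < x -> x <= y ->
  y `^ (- e) <= x `^ (- e).
Proof.
move=> e0 x0 xy; have y0 := lt_le_trans x0 xy.
by rewrite !powRN lef_pV2 ?posrE ?powR_gt0// ge0_ler_powR// nnegrE ltW.
Qed.

(** The predecessor of the least [n] with [t < G n] works; [G 0%N <= t] ensures that this [n] is
    positive. *)
Lemma crossing_level (R : realType) (G : nat -> R) (t : R) :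
  G @ \oo --> +oo -> G 0%N <= t -> exists m, G m <= t < G m.+1.
Proof.
move=> /cvgryPgt /(_ t) [N _ GN] G0t.
have exG : exists n, t < G n by exists N; exact: (GN N (leqnn N)).
case: (ex_minnP exG) => -[|m] tG minm; first by rewrite ltNge G0t in tG.
by exists m; rewrite tG andbT leNgt; apply/negP => /minm; rewrite ltnn.
Qed.

Lemma interpolate_levels (R : realType) (G : nat -> R) (gamma K S D d : R) :
  1 < gamma -> (forall m, 0 < G m) -> G @ \oo --> +oo ->
  0 <= K -> 0 <= S -> 0 <= D -> d <= S ->
  (forall m, d <= G m * D + K * G m.+1 `^ (1 - gamma) * S) ->
  d <= (1 + K + G 0%N `^ (gamma - 1)) * S `^ (gamma^-1)
         * D `^ ((gamma - 1) / gamma).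
Proof.
move=> g1 Gpos Glim K0 S0 D0 dS dlev.
have g0 : 0 < gamma by rewrite (lt_trans _ g1).
have gN0 : gamma != 0 by rewrite gt_eqF.
have gp : 0 <= gamma - 1 by rewrite subr_ge0 ltW.
have C0 : 0 <= 1 + K + G 0%N `^ (gamma - 1) by rewrite !addr_ge0 ?powR_ge0.
have [SE|SN0] := eqVneq S 0.
  by rewrite (le_trans dS)// SE !mulr_ge0 ?powR_ge0.
have Spos : 0 < S by rewrite lt_def SN0.
have [DE|DN0] := eqVneq D 0.
  rewrite DE powR0 ?mulf_neq0 ?invr_eq0 ?subr_eq0 ?gt_eqF// mulr0 leNgt.
  apply/negP => d0.
  have [KE|KN0] := eqVneq K 0.
    by have := dlev 0%N; rewrite DE KE mulr0 !mul0r addr0 leNgt d0.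
  have L0 : 0 < K * S by rewrite mulr_gt0// lt_def KN0.
  pose u := d / (2 * (K * S)).
  have u0 : 0 < u by rewrite divr_gt0// mulr_gt0.
  (* This [t] solves [t]^ (1 - gamma) = u[, so a level with]t <= G m.+1[has]K * G m.+1
     [^ (1 - gamma) * S] at most [d / 2], contradicting [0 < d]. *)
  pose t := u `^ (- (gamma - 1)^-1).
  have t0 : 0 < t by exact: powR_gt0.
  have [m /andP[_ tG]] : exists m, G m <= Num.max t (G 0%N) < G m.+1.
    by apply: crossing_level => //; rewrite le_max lexx orbT.
  have {}tG : t <= G m.+1 by rewrite ltW// (le_lt_trans _ tG)// le_max lexx.
  have := le_powR_opp gp t0 tG.
  rewrite /t -powRrM mulrNN mulVf ?subr_eq0 ?gt_eqF// powRr1 ?(ltW u0)// opprB.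
  move=> le_u; have := dlev m; rewrite DE mulr0 add0r mulrAC.
  have := ler_wpM2l (ltW L0) le_u.
  have -> : K * S * u = d / 2 by rewrite /u; field; rewrite SN0 KN0.
  by lra.
have Dpos : 0 < D by rewrite lt_def DN0.
pose t := (S / D) `^ gamma^-1.
have t0 : 0 < t by rewrite powR_gt0// divr_gt0.
have tg : t `^ gamma * D = S.
  by rewrite -powRrM mulVf// powRr1 ?divr_ge0// divfK.
have tD : S `^ gamma^-1 * D `^ ((gamma - 1) / gamma) = t * D.
  rewrite -tg powRM ?powR_ge0// -powRrM divff// powRr1 ?(ltW t0)// -mulrA.
  rewrite -powRD ?DN0 ?implybT// (_ : _ + _ = 1) ?powRr1//; first by field.
have tg1 : t * t `^ (gamma - 1) = t `^ gamma by rewrite mulr_powRB1// ltW.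
have tD0 : 0 < t * D by rewrite mulr_gt0.
rewrite -mulrA tD.
have G00 := powR_ge0 (G 0%N) (gamma - 1).
have [G0t|tG0] := leP (G 0%N) t.
  have [m /andP[Gt tG]] := crossing_level Glim G0t.
  apply: (le_trans (dlev m)).
  have h1 : G m * D <= t * D by rewrite ler_wpM2r.
  (* The exponent [1 - gamma] is negative, so [t < G m.+1] bounds the left side by its value at [t],
     the balance point. *)
  have h2 : G m.+1 `^ (1 - gamma) * S <= t * D.
    have -> : t * D = t `^ (1 - gamma) * S.
      by rewrite -tg mulrA -powRD ?(gt_eqF t0) ?implybT// subrK powRr1// ltW.
    by rewrite ler_wpM2r// -opprB le_powR_opp// ltW.
  rewrite -mulrA.
  by have := ler_wpM2l K0 h2; nra.
apply: (le_trans dS); rewrite -tg -tg1.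
have : t `^ (gamma - 1) <= G 0%N `^ (gamma - 1).
  by apply: ge0_ler_powR => //; rewrite ?nnegrE ltW.
move=> h; have := ler_wpM2r (ltW tD0) h.
by have := mulr_ge0 K0 (ltW tD0); nra.
Qed.

(* Index n : nat stands for the positive integer n + 1; in particular G 0 is
   the paper's G(1), and G m.+1 is its G(m + 1) for the space V m. *)
Theorem theorem2p7 (R : realType) :
  exists C : R -> R -> R -> R -> R,
  forall (k : scalar_kind) (H : hilbert R k)
    (Hinf : infinite_dimensional H) (Hsep : separable H)
    (Phi : nat -> H) (A B : R) (HPhi : frame Phi A B)
    (V : nat -> set H) (d : nat -> nat)
    (HV : forall m, has_dim (V m) (d m))
    (Hd : forall m, (d m < d m.+1)%N)
    (G : nat -> R) (Gpos : forall m, 0 < G m)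
    (Ginc : {homo G : m n / (m <= n)%N >-> m <= n})
    (Glim : G @ \oo --> +oo)
    (HG : forall m (f g : H), V m f -> V m g ->
            phase_dist f g <= G m * ampl_dist Phi f g)
    (gamma r : R) (Hgamma : 1 < gamma) (Hr : 0 < r) (f g : H),
    approx_class V G gamma r f -> approx_class V G gamma r g ->
    phase_dist f g
      <= C B r gamma (G 0%N)
         * (rnorm f + rnorm g) `^ (gamma^-1)
         * ampl_dist Phi f g `^ ((gamma - 1) / gamma).
Proof.
exists (fun B r gamma G0 =>
  1 + (G0^-1 + Num.sqrt B) * r + G0 `^ (gamma - 1)).
move=> k H _ _ Phi A B HPhi V d HV _ G Gpos Ginc Glim HG gamma r g1 r0 f g Hf Hg.
have s0 := sqrtr_ge0 B.
have S0 : 0 <= rnorm f + rnorm g by rewrite addr_ge0 ?rnorm_ge0.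
have iG0 : 0 < (G 0%N)^-1 by rewrite invr_gt0.
apply: interpolate_levels => //.
- by rewrite mulr_ge0 ?(ltW r0)// addr_ge0 ?(ltW iG0).
- exact: ampl_dist_ge0.
- exact: phase_dist_leD.
move=> m.
have Vf := orthoproj_in f (HV m); have Vg := orthoproj_in g (HV m).
apply: (le_trans (phase_dist_level HPhi (ltW (Gpos m)) (HG m _ _ Vf Vg)
  (Hf m) (Hg m))).
rewrite lerD2l ler_wpM2r//.
(* One factor [(G m.+1)^-1] of the decay is spent on [1 + G m * Num.sqrt B]: since [G] is monotone,
   the product is at most [(G 0%N)^-1 + Num.sqrt B]. *)
have -> : G m.+1 `^ (- gamma) = G m.+1 `^ (1 - gamma) / G m.+1.
  rewrite -[in RHS](powR_inv1 (ltW (Gpos _))) -powRD ?(gt_eqF (Gpos _)) ?implybT//.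
  by congr (_ `^ _); ring.
have -> : (1 + G m * Num.sqrt B) * (G m.+1 `^ (1 - gamma) / G m.+1 * r) =
    ((G m.+1)^-1 + G m / G m.+1 * Num.sqrt B) * r * G m.+1 `^ (1 - gamma).
  by ring.
rewrite ler_wpM2r ?powR_ge0// ler_wpM2r ?(ltW r0)//; apply: lerD.
  by rewrite lef_pV2 ?posrE// Ginc.
by rewrite ler_piMl// ler_pdivrMr// mul1r Ginc.
Qed.
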